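(* Let $V_1=(1,b_1,c_1,d_1)$, $V_2=(0,b_2,c_2,0)$, $V_3=(0,0,0,d_3)$ in $\mathfrak{se}(2)\times\mathbb{R}$ with $0\neq d_3\neq d_1$ and $b_2^2+c_2^2\neq 0$. Consider the map $\mathcal{IK}:\mathrm{SE}(2)\times\mathbb{R}\to\mathbb{R}^4$ given by $$\mathcal{IK}(\theta,x,y,z)=\Big(\operatorname{arctan2}(\alpha,\beta),\ \rho,\ \theta-\operatorname{arctan2}(\alpha,\beta),\ \frac{z-d_1\theta}{d_3}\Big),$$ where $\rho=\sqrt{\alpha^2+\beta^2}$ and $$\begin{bmatrix}\alpha\\ \beta\end{bmatrix}=\frac{1}{b_2^2+c_2^2}\begin{bmatrix}b_2&c_2\\ -c_2&b_2\end{bmatrix}\left(\begin{bmatrix}x\\ y\end{bmatrix}-\begin{bmatrix}-c_1&b_1\\ b_1&c_1\end{bmatrix}\begin{bmatrix}1-\cos\theta\\ \sin\theta\end{bmatrix}\right).$$ Then $\mathcal{IK}$ is a global right inverse of the map $\mathcal{FK}^{(1,2,1,3)}:\mathbb{R}^4\to\mathrm{SE}(2)\times\mathbb{R}$, $\mathcal{FK}^{(1,2,1,3)}(t_1,t_2,t_3,t_4)=\exp(t_1V_1)\exp(t_2V_2)\exp(t_3V_1)\exp(t_4V_3)$; that is, $\mathcal{FK}^{(1,2,1,3)}\circ\mathcal{IK}=\mathrm{id}_{\mathrm{SE}(2)\times\mathbb{R}}$.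
   Context: $\mathrm{SE}(2)\times\mathbb{R}$ is the direct product of the matrix group $\mathrm{SE}(2)$ and the additive group $\mathbb{R}$, with Lie algebra $\mathfrak{se}(2)\times\mathbb{R}$. Elements of $\mathfrak{se}(2)\times\mathbb{R}$ are written $(a,b,c,d)=a e_\theta+b e_x+c e_y+d e_z$, where $e_z$ spans the $\mathbb{R}$ factor and $$e_\theta=\begin{bmatrix}0&-1&0\\ 1&0&0\\ 0&0&0\end{bmatrix},\quad e_x=\begin{bmatrix}0&0&1\\ 0&0&0\\ 0&0&0\end{bmatrix},\quad e_y=\begin{bmatrix}0&0&0\\ 0&0&1\\ 0&0&0\end{bmatrix}$$ span $\mathfrak{se}(2)$. Elements of $\mathrm{SE}(2)\times\mathbb{R}$ are written $(\theta,x,y,z)$, with $z\in\mathbb{R}$ and $(\theta,x,y)\equiv\begin{bmatrix}\cos\theta&-\sin\theta&x\\ \sin\theta&\cos\theta&y\\ 0&0&1\end{bmatrix}$. The angle $\theta$ is determined by the group element only modulo $2\pi$; in the formula for $\mathcal{IK}$, $\theta$ is a fixed choice of real representative (for instance in $(-\pi,\pi]$). $\exp$ is the exponential map, given component-wise by the matrix exponential on $\mathfrak{se}(2)$ and the identity $d\mapsto d$ on $\mathbb{R}$. $\operatorname{arctan2}(x,y)$ denotes the arctangent of $y/x$ taking into account the quadrant of the point $(x,y)$ (i.e. the polar angle of $(x,y)$, in $(-\pi,\pi]$), with the convention $\operatorname{arctan2}(0,0)=0$; note the order of arguments. *)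

(* Defs.v *)
From mathcomp Require Import all_boot all_order all_algebra.
From mathcomp Require Import all_classical all_reals all_analysis.
Set Implicit Arguments. Unset Strict Implicit. Unset Printing Implicit Defensive.
Import Order.TTheory GRing.Theory Num.Theory.
Import numFieldNormedType.Exports.
Local Open Scope classical_set_scope.
Local Open Scope ring_scope.

(* The m x n matrix with the given list of rows. *)
Definition mx_rows {R : realType} (m n : nat) (s : seq (seq R)) : 'M[R]_(m, n) :=
  \matrix_(i < m, j < n) (nth [::] s i)`_j.

Definition expmx {R : realType} (n : nat) (A : 'M[R]_n.+1) : 'M[R]_n.+1 :=
  limn (series (fun k : nat => (k`!%:R)^-1 *: A ^+ k)).

(* Common ambient vector space of the Lie algebra se(2) x R and of the group
   SE(2) x R; as R^o is a module over R, it carries the linear structure used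
   for se(2) x R. *)
Notation amb R := ('M[R]_3 * R^o)%type.

Section SE2R.
Variable R : realType.

Definition e_theta : amb R :=
  (mx_rows 3 3 [:: [:: 0; -1; 0]; [:: 1; 0; 0]; [:: 0; 0; 0]], 0).
Definition e_x : amb R :=
  (mx_rows 3 3 [:: [:: 0; 0; 1]; [:: 0; 0; 0]; [:: 0; 0; 0]], 0).
Definition e_y : amb R :=
  (mx_rows 3 3 [:: [:: 0; 0; 0]; [:: 0; 0; 1]; [:: 0; 0; 0]], 0).
Definition e_z : amb R := (0, 1).

Definition se2R_vec (a b c d : R) : amb R :=
  a *: e_theta + b *: e_x + c *: e_y + d *: e_z.

Definition SE2R_elt (theta x y z : R) : amb R :=
  (mx_rows 3 3 [:: [:: cos theta; - sin theta; x];
                   [:: sin theta;   cos theta; y];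
                   [:: 0;           0;         1]], z).

Definition SE2R : set (amb R) :=
  [set g | exists theta x y z, g = SE2R_elt theta x y z].

(* Multiplicative on the matrix factor, additive on the factor R. *)
Definition SE2R_mul (g h : amb R) : amb R := (g.1 *m h.1, g.2 + h.2).

Definition SE2R_exp (V : amb R) : amb R := (expmx V.1, V.2).

Definition FK1213 (V1 V2 V3 : amb R) (t : 'rV[R]_4) : amb R :=
  SE2R_mul (SE2R_mul (SE2R_mul (SE2R_exp (t 0 0 *: V1)) (SE2R_exp (t 0 1 *: V2)))
                     (SE2R_exp (t 0 2 *: V1)))
           (SE2R_exp (t 0 3 *: V3)).

(* Polar angle of the point (x, y), in ]-pi, pi]; the abscissa comes first. *)
Definition arctan2 (x y : R) : R :=
  if 0 < x then atan (y / x)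
  else if x < 0 then (if 0 <= y then atan (y / x) + pi else atan (y / x) - pi)
  else if 0 < y then pi / 2
  else if y < 0 then - (pi / 2)
  else 0.

(* A choice, for each group element, of a real representative of its angle,
   which the element determines only modulo 2 pi. *)
Definition angle_choice (th : amb R -> R) : Prop :=
  forall g, SE2R g -> exists x y z, g = SE2R_elt (th g) x y z.

Definition IK_alphabeta (b1 c1 b2 c2 theta x y : R) : 'cV[R]_2 :=
  (b2 ^+ 2 + c2 ^+ 2)^-1 *:
    (mx_rows 2 2 [:: [:: b2; c2]; [:: - c2; b2]] *m
      (mx_rows 2 1 [:: [:: x]; [:: y]]
       - mx_rows 2 2 [:: [:: - c1; b1]; [:: b1; c1]] *m
           mx_rows 2 1 [:: [:: 1 - cos theta]; [:: sin theta]])).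

Definition IK_coord (b1 c1 d1 b2 c2 d3 theta x y z : R) : 'rV[R]_4 :=
  let ab := IK_alphabeta b1 c1 b2 c2 theta x y in
  let alpha := ab 0 0 in
  let beta := ab 1 0 in
  let rho := Num.sqrt (alpha ^+ 2 + beta ^+ 2) in
  mx_rows 1 4 [:: [:: arctan2 alpha beta; rho;
                      theta - arctan2 alpha beta; (z - d1 * theta) / d3]].

(* The coordinates x, y are read off the last column of the matrix. *)
Definition IK (th : amb R -> R) (b1 c1 d1 b2 c2 d3 : R) (g : amb R) : 'rV[R]_4 :=
  IK_coord b1 c1 d1 b2 c2 d3 (th g) (g.1 0 2) (g.1 1 2) g.2.

End SE2R.

(* Main.v *)
Require Import Defs.
From mathcomp Require Import all_boot all_order all_algebra.
From mathcomp Require Import all_classical all_reals all_analysis.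
From mathcomp Require Import ring.
Import Order.TTheory GRing.Theory Num.Theory.
Import numFieldNormedType.Exports.
Local Open Scope classical_set_scope.
Local Open Scope ring_scope.

(** If [B ^+ 3 = - B], every term [(t *: B) ^+ k / k!] of the exponential series
    combines the terms of the sine and cosine series on [B] and [- B ^+ 2],
    corrected at [k = 0] by [1 + B ^+ 2]; this gives Rodrigues' formula
    [exp (t B) = 1 + sin t B + (1 - cos t) B ^+ 2]. The matrix part of [V1] is of
    this kind, those of [V2] and [V3] square to zero, so [FK1213] has a closed
    form: its angle is [t1 + t3], its translation is that of
    [exp ((t1 + t3) V1)] plus [(b2, c2)] scaled by [t2] and rotated by [t1].
    Inverting it amounts to writing [(alpha, beta)] in polar coordinates. *)

Lemma cvg_series_delta0 {R : realType} :
  series (fun k : nat => (k == 0)%:R : R) @ \oo --> (1 : R).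
Proof.
rewrite -(cvg_shiftn 1) /=.
rewrite (_ : (fun n => _) = fun=> 1 : R); first exact: cvg_cst.
by apply/funext => n; rewrite addn1 /series /= big_nat_recl //= big1 // addr0.
Qed.

Lemma expmx_sqr0 {R : realType} (n : nat) (A : 'M[R]_n.+1) :
  A ^+ 2 = 0 -> expmx A = 1 + A.
Proof.
move=> A2; apply: cvg_lim; first exact: norm_hausdorff.
(* From rank 2 on, the partial sums are constant. *)
rewrite -(cvg_shiftn 2) /=.
rewrite (_ : (fun k => _) = fun=> 1 + A); first exact: cvg_cst.
apply/funext => k; rewrite addn2 /series /= !big_nat_recl //= big1 => [|i _].
  by rewrite expr0 expr1 !fact0 invr1 !scale1r addr0.
by rewrite -addn2 exprD A2 mulr0 scaler0.
Qed.

Lemma exp_term_sin_cos {R : realType} (n : nat) (B : 'M[R]_n.+1) (t : R)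
    (k : nat) : B ^+ 3 = - B ->
  (k`!%:R)^-1 *: (t *: B) ^+ k =
  sin_coeff t k *: B + cos_coeff t k *: - B ^+ 2
    + (k == 0)%:R *: (1 + B ^+ 2).
Proof.
move=> B3.
have Bodd m : B ^+ m.*2.+1 = (-1) ^+ m *: B.
  elim: m => [|m IH]; first by rewrite expr1 expr0 scale1r.
  rewrite doubleS -addn2 exprD IH -scalerAl -exprS B3 exprS mulN1r.
  by rewrite scalerN scaleNr.
rewrite exprZn /sin_coeff /cos_coeff /= scalerA.
case: k => [|k] /=.
  rewrite !expr0 expr0z fact0 !mul0r !mul1r invr1 scale0r add0r !scale1r.
  by rewrite mulr1 scale1r addrCA addNr addr0.
rewrite scale0r addr0; have := odd_double_half k.
(* [k] is now the predecessor of the exponent, so an odd [k] gives the cosine term. *)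
case: (boolP (odd k)) => k_odd /= kE.
  have -> : B ^+ k.+1 = (-1) ^+ k./2 *: B ^+ 2.
    by rewrite -{1}kE exprS add1n Bodd -scalerAr -expr2.
  rewrite !mul0r scale0r add0r mul1r scalerN -scaleNr scalerA.
  (* Here [uphalf k] is [k./2 + 1]; the extra sign cancels the one in [- B ^+ 2]. *)
  rewrite uphalf_half k_odd add1n -exprnP (exprS (-1)) mulN1r !mulNr opprK.
  by congr (_ *: _); rewrite [RHS]mulrC mulrA mulrAC.
have -> : B ^+ k.+1 = (-1) ^+ k./2 *: B by rewrite -{1}kE Bodd.
by rewrite !mul0r scale0r addr0 mul1r scalerA; congr (_ *: _); rewrite [RHS]mulrC mulrA mulrAC.
Qed.

Lemma expmx_rodrigues {R : realType} (n : nat) (B : 'M[R]_n.+1) (t : R) :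
  B ^+ 3 = - B ->
  expmx (t *: B) = 1 + sin t *: B + (1 - cos t) *: B ^+ 2.
Proof.
move=> B3; apply: cvg_lim; first exact: norm_hausdorff.
pose u := fun m => series (sin_coeff t) m *: B
    + series (cos_coeff t) m *: - B ^+ 2
    + series (fun k : nat => (k == 0)%:R) m *: (1 + B ^+ 2).
rewrite (_ : series _ = u); last first.
  apply/funext => m; rewrite /u /series /= !scaler_suml -!big_split /=.
  by apply: eq_bigr => i _; exact: exp_term_sin_cos.
rewrite (_ : 1 + _ + _ = sin t *: B + cos t *: - B ^+ 2 + 1 *: (1 + B ^+ 2)).
  apply: cvgD; first apply: cvgD.
  (* Once unlocked, [sin t] is by definition the limit of this series, so its convergence is
     enough. *)
  - by apply: cvgZr_tmp; rewrite unlock; exact: is_cvg_series_sin_coeff.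
  - by apply: cvgZr_tmp; rewrite unlock; exact: is_cvg_series_cos_coeff.
  - by apply: cvgZr_tmp; exact: cvg_series_delta0.
rewrite scale1r scalerBl scale1r scalerN [1 + _]addrC -!addrA; congr (_ + _).
by rewrite [RHS]addrC -addrA.
Qed.

Ltac mx3_entries :=
  apply/matrixP => -[[|[|[|//]]] ?] [[|[|[|//]]] ?];
  rewrite ?mxE /= ?big_ord_recl ?big_ord0 /= ?mxE /=.

Lemma se2R_vec_mx {R : realType} (a b c d : R) :
  se2R_vec a b c d =
  (mx_rows 3 3 [:: [:: 0; - a; b]; [:: a; 0; c]; [:: 0; 0; 0]], d).
Proof.
rewrite [LHS]surjective_pairing; congr pair => /=; last first.
  by rewrite !scaler0 !add0r /GRing.scale /= mulr1.
by mx3_entries; ring.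
Qed.

(** The planar motion is a rotation about [p = (- c, b)], where the vector field of the generator
    vanishes; its translation part is [p - R p], with [R] the linear rotation of angle [t]. *)
Lemma SE2R_exp_rot {R : realType} (b c d t : R) :
  SE2R_exp (t *: se2R_vec 1 b c d) =
  SE2R_elt t (b * sin t - c * (1 - cos t)) (c * sin t + b * (1 - cos t)) (t * d).
Proof.
rewrite se2R_vec_mx [LHS]surjective_pairing; congr pair => //=.
set B := mx_rows _ _ _.
have B2 : B ^+ 2 = mx_rows 3 3 [:: [:: -1; 0; - c]; [:: 0; -1; b]; [:: 0; 0; 0]].
  by rewrite expr2; mx3_entries; rewrite ?mxE /=; ring.
rewrite expmx_rodrigues; last first.
  by rewrite exprS B2; mx3_entries; rewrite ?mxE /=; ring.
by rewrite B2; mx3_entries; ring.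
Qed.

(** Serves both [V2] and [V3], the latter with [b = c = 0]. *)
Lemma SE2R_exp_trans {R : realType} (b c d t : R) :
  SE2R_exp (t *: se2R_vec 0 b c d) = SE2R_elt 0 (t * b) (t * c) (t * d).
Proof.
rewrite se2R_vec_mx [LHS]surjective_pairing; congr pair => //=.
rewrite expmx_sqr0; last by rewrite expr2; mx3_entries; rewrite ?mxE /=; ring.
by mx3_entries; rewrite ?cos0 ?sin0; ring.
Qed.

Lemma SE2R_mul_elt {R : realType} (t x y z s x' y' z' : R) :
  SE2R_mul (SE2R_elt t x y z) (SE2R_elt s x' y' z') =
  SE2R_elt (t + s) (x + cos t * x' - sin t * y') (y + sin t * x' + cos t * y')
    (z + z').
Proof.
rewrite [LHS]surjective_pairing; congr pair => //=.
by mx3_entries; rewrite ?mxE /= ?cosD ?sinD; ring.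
Qed.

Lemma FK1213E {R : realType} (b1 c1 d1 b2 c2 d3 : R) (t : 'rV[R]_4) :
  let th := t 0 0 + t 0 2 in
  FK1213 (se2R_vec 1 b1 c1 d1) (se2R_vec 0 b2 c2 0) (se2R_vec 0 0 0 d3) t =
  SE2R_elt th
    (b1 * sin th - c1 * (1 - cos th)
      + (t 0 1 * cos (t 0 0) * b2 - t 0 1 * sin (t 0 0) * c2))
    (c1 * sin th + b1 * (1 - cos th)
      + (t 0 1 * sin (t 0 0) * b2 + t 0 1 * cos (t 0 0) * c2))
    (d1 * th + t 0 3 * d3).
Proof.
rewrite /FK1213 (SE2R_exp_rot _ _ _ (t 0 0)) (SE2R_exp_rot _ _ _ (t 0 2)).
rewrite (SE2R_exp_trans b2) (SE2R_exp_trans 0 0 d3).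
move: (t 0 0) (t 0 1) (t 0 2) (t 0 3) => t0 t1 t2 t3 /=.
rewrite !SE2R_mul_elt !addr0 cosD sinD.
by congr SE2R_elt; ring.
Qed.

Lemma cos_atan_gt0 {R : realType} (x : R) : 0 < cos (atan x).
Proof. by rewrite cos_gt0_pihalf // atan_gtNpi2 atan_ltpi2. Qed.

Lemma sin_atanE {R : realType} (x : R) : sin (atan x) = x * cos (atan x).
Proof. by rewrite -{2}(atanK x) /tan divfK // gt_eqF // cos_atan_gt0. Qed.

(** Factoring [x ^+ 2] out of the root leaves the root of [1 + (y / x) ^+ 2], which is the inverse
    of [cos (atan (y / x))]. *)
Lemma hypot_atan {R : realType} (x y : R) : x != 0 ->
  Num.sqrt (x ^+ 2 + y ^+ 2) * cos (atan (y / x)) = `|x|.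
Proof.
move=> x0; have -> : x ^+ 2 + y ^+ 2 = x ^+ 2 * (1 + (y / x) ^+ 2) by field.
have q : 0 < 1 + (y / x) ^+ 2 by rewrite ltr_wpDr // sqr_ge0.
by rewrite sqrtrM ?sqr_ge0 // sqrtr_sqr cos_atan mulfK // gt_eqF // sqrtr_gt0.
Qed.

Lemma arctan2_polar {R : realType} (x y : R) :
  let rho := Num.sqrt (x ^+ 2 + y ^+ 2) in
  rho * cos (arctan2 x y) = x /\ rho * sin (arctan2 x y) = y.
Proof.
have cosBpi (a : R) : cos (a - pi) = - cos a.
  by rewrite -[X in - cos X](subrK pi) cosDpi opprK.
have sinBpi (a : R) : sin (a - pi) = - sin a.
  by rewrite -[X in - sin X](subrK pi) sinDpi opprK.
rewrite /arctan2 /=; have [x0|x0|<-] := ltrgtP 0 x.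
- rewrite sin_atanE mulrCA hypot_atan ?gt_eqF // gtr0_norm //.
  by rewrite divfK // gt_eqF.
- have nx0 : x != 0 by rewrite lt_eqF.
  (* Shifting by [pi] either way negates cosine and sine, which compensates [|x| = - x]; the sign of
     [y] is irrelevant. *)
  case: ifP => _; rewrite ?cosDpi ?sinDpi ?cosBpi ?sinBpi !mulrN sin_atanE;
  by rewrite mulrCA hypot_atan // ltr0_norm // mulrN !opprK divfK.
- rewrite expr0n /= add0r sqrtr_sqr; have [y0|y0|<-] := ltrgtP 0 y.
  + by rewrite cos_pihalf sin_pihalf mulr0 mulr1 gtr0_norm.
  + by rewrite cosN sinN cos_pihalf sin_pihalf mulr0 mulrN1 ltr0_norm // opprK.
  (* At the origin the radius is 0, so the default angle does no harm. *)
  + by rewrite normr0 !mul0r.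
Qed.

(** The matrix with rows [(b2, c2)] and [(- c2, b2)], divided by [b2 ^+ 2 + c2 ^+ 2], inverts the
    one with rows [(b2, - c2)] and [(c2, b2)]. The left-hand sides are the translation in [FK1213E],
    with [t2 (cos t1, sin t1)] replaced by [(alpha, beta)]. *)
Lemma IK_alphabetaK {R : realType} (b1 c1 b2 c2 theta x y : R) :
  b2 ^+ 2 + c2 ^+ 2 != 0 ->
  let ab := IK_alphabeta b1 c1 b2 c2 theta x y in
  b1 * sin theta - c1 * (1 - cos theta) + (ab 0 0 * b2 - ab 1 0 * c2) = x /\
  c1 * sin theta + b1 * (1 - cos theta) + (ab 1 0 * b2 + ab 0 0 * c2) = y.
Proof.
move=> n0 /=; rewrite /IK_alphabeta.
by rewrite !(mxE, big_ord_recl, big_ord0) /=; split; field.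
Qed.

Theorem mainTheorem5 (R : realType) (b1 c1 d1 b2 c2 d3 : R) (th : amb R -> R)
    (d3_neq0 : d3 != 0) (d3_neq_d1 : d3 != d1)
    (bc2_neq0 : b2 ^+ 2 + c2 ^+ 2 != 0)
    (th_angle : angle_choice th) :
  let V1 := se2R_vec 1 b1 c1 d1 in
  let V2 := se2R_vec 0 b2 c2 0 in
  let V3 := se2R_vec 0 0 0 d3 in
  let FK := FK1213 V1 V2 V3 in
  (forall t : 'rV[R]_4, SE2R (FK t)) /\
  (forall g : amb R, SE2R g -> FK (IK th b1 c1 d1 b2 c2 d3 g) = g).
Proof.
split=> [t|g /th_angle[x [y [z]]]].
  by rewrite FK1213E; do 4!eexists.
rewrite FK1213E /IK; move: (th g) => theta ->.
have -> : (SE2R_elt theta x y z).1 0 2 = x by rewrite mxE.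
have -> : (SE2R_elt theta x y z).1 1 2 = y by rewrite mxE.
have [] := IK_alphabetaK b1 c1 b2 c2 theta x y bc2_neq0.
rewrite /IK_coord; move: (IK_alphabeta _ _ _ _ _ _ _ 0 0).
move: (IK_alphabeta _ _ _ _ _ _ _ 1 0) => be al Ex Ey.
have [Ecos Esin] := arctan2_polar al be.
(* The first and third coordinates add up to [theta] as a real number, not only modulo [2 pi], so
   [d1 * theta] cancels in the last component. *)
rewrite !mxE /= subrKC Ecos Esin Ex Ey.
by congr SE2R_elt; field.
Qed.
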